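(* The state $\boldsymbol{h}$ is the Haar measure of the braided compact quantum group $\mathrm{SU}_q(2)$, i.e. $$(\boldsymbol{h}\boxtimes\mathrm{id})\Delta_A(a)=(\mathrm{id}\boxtimes\boldsymbol{h})\Delta_A(a)=\boldsymbol{h}(a)1\qquad\text{for all }a\in A.$$
   Context: Fix $q\in\mathbb{C}$ with $0<|q|<1$ and put $\zeta=q/\overline{q}\in\mathbb{T}$. $A$ is the universal unital $C^*$-algebra generated by $\alpha,\gamma$ with $\alpha^*\alpha+\gamma^*\gamma=1$, $\alpha\alpha^*+|q|^2\gamma^*\gamma=1$, $\alpha\gamma=\overline{q}\gamma\alpha$, $\gamma\gamma^*=\gamma^*\gamma$. Let $\boldsymbol{z}\in C(\mathbb{T})$ be the identity function. $\mathbb{T}$ acts on $A$ via the unital $*$-homomorphism $\rho^A\colon A\to C(\mathbb{T})\otimes A$, $\rho^A(\alpha)=1\otimes\alpha$, $\rho^A(\gamma)=\boldsymbol{z}\otimes\gamma$; an element $x$ is homogeneous of degree $\deg(x)=n\in\mathbb{Z}$ if $\rho^A(x)=\boldsymbol{z}^n\otimes x$. Let $C(\mathbb{T}^2_\zeta)$ be the universal $C^*$-algebra generated by unitaries $U,V$ with $UV=\zeta VU$. The braided tensor product $A\boxtimes A$ is the closed linear span of $\{\iota_1(x)\iota_2(y)\}$ in $C(\mathbb{T}^2_\zeta)\otimes A\otimes A$, where $\iota_1,\iota_2$ are the unital $*$-homomorphisms with $\iota_1(x)=U^{\deg(x)}\otimes x\otimes 1$, $\iota_2(y)=V^{\deg(y)}\otimes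 1\otimes y$ for homogeneous $x,y$. The comultiplication is the unital $*$-homomorphism $\Delta_A\colon A\to A\boxtimes A$ with $\Delta_A(\alpha)=\iota_1(\alpha)\iota_2(\alpha)-q\iota_1(\gamma^* )\iota_2(\gamma)$, $\Delta_A(\gamma)=\iota_1(\gamma)\iota_2(\alpha)+\iota_1(\alpha^* )\iota_2(\gamma)$. The state $\boldsymbol{h}$: let $B$ be the universal unital $C^*$-algebra generated by $\alpha,\gamma,z$ where $\alpha,\gamma$ satisfy the defining relations of $A$ and $z$ is unitary with $z\alpha z^*=\alpha$, $z\gamma z^*=\zeta^{-1}\gamma$; with the unital $*$-homomorphism $\Delta_B\colon B\to B\otimes B$, $\Delta_B(\alpha)=\alpha\otimes\alpha-q\gamma^*z\otimes\gamma$, $\Delta_B(\gamma)=\gamma\otimes\alpha+\alpha^*z\otimes\gamma$, $\Delta_B(z)=z\otimes z$, it is a compact quantum group (the bosonization of $\mathrm{SU}_q(2)$); $\boldsymbol{h}_B$ is its Haar state. With $\kappa\colon A\to B$ the unital $*$-homomorphism $\alpha\mapsto\alpha,\gamma\mapsto\gamma$, put $\boldsymbol{h}=\boldsymbol{h}_B\circ\kappa$. The braided slice maps $\boldsymbol{h}\boxtimes\mathrm{id},\ \mathrm{id}\boxtimes\boldsymbol{h}\colon A\boxtimes A\to A$ are the unital completely positive maps with $(\boldsymbol{h}\boxtimes\mathrm{id})(\iota_1(a)\iota_2(b))=\boldsymbol{h}(a)b$ and $(\mathrm{id}\boxtimes\boldsymbol{h})(\iota_1(a)\iota_2(b))=\boldsymbol{h}(b)a$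 for $a,b\in A$. *)

(* Defs.v *)
From HB Require Import structures.
From mathcomp Require Import all_boot all_order all_algebra.
From mathcomp Require Import complex.
From mathcomp Require Import boolp classical_sets topology normedtype.

Set Implicit Arguments.
Unset Strict Implicit.
Unset Printing Implicit Defensive.

Import Order.TTheory GRing.Theory Num.Theory.
Import numFieldNormedType.Exports.

Local Open Scope classical_set_scope.
Local Open Scope ring_scope.

(* A unital C*-algebra over C. It is packed as a record with its own
   multiplication, and not as an HB structure, because HB has no structure joining
   the normed modules with the rings below numDomainType; the MathComp structures
   are recovered by the instances that follow. Norms take values in C itself, as
   for every normed module over a numFieldType. As MathComp algebras satisfy
   1 != 0, so do these; the zero algebra plays no role below, since every relation
   holds in it and it receives exactly one map from each algebra. *)
Record cstarAlgType (C : numClosedFieldType) := CStarAlg {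
  cstar_module : completeNormedModType C;
  cstar_one : cstar_module;
  cstar_mul : cstar_module -> cstar_module -> cstar_module;
  cstar_star : cstar_module -> cstar_module;
  cstar_mulA : associative cstar_mul;
  cstar_mul1x : left_id cstar_one cstar_mul;
  cstar_mulx1 : right_id cstar_one cstar_mul;
  cstar_mulDl : left_distributive cstar_mul +%R;
  cstar_mulDr : right_distributive cstar_mul +%R;
  cstar_mulZl : forall (k : C) x y, k *: cstar_mul x y = cstar_mul (k *: x) y;
  cstar_mulZr : forall (k : C) x y, k *: cstar_mul x y = cstar_mul x (k *: y);
  cstar_one_neq0 : cstar_one != 0;
  cstar_starK : involutive cstar_star;
  cstar_starD : {morph cstar_star : x y / x + y};
  cstar_starZ : forall (k : C) x, cstar_star (k *: x) = k^* *: cstar_star x;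
  cstar_starM : forall x y,
    cstar_star (cstar_mul x y) = cstar_mul (cstar_star y) (cstar_star x);
  cstar_normM : forall x y, `|cstar_mul x y| <= `|x| * `|y|;
  cstar_norm_star : forall x, `|cstar_mul (cstar_star x) x| = `|x| ^+ 2
}.

Definition cstar_sort (C : numClosedFieldType) (A : cstarAlgType C) : Type :=
  cstar_module A.
Coercion cstar_sort : cstarAlgType >-> Sortclass.

Section CStarInstances.
Variables (C : numClosedFieldType) (A : cstarAlgType C).

HB.instance Definition _ :=
  CompleteNormedModule.copy (cstar_sort A) (cstar_module A).
HB.instance Definition _ := GRing.Zmodule_isNzRing.Build (cstar_sort A)
  (@cstar_mulA C A) (@cstar_mul1x C A) (@cstar_mulx1 C A)
  (@cstar_mulDl C A) (@cstar_mulDr C A) (@cstar_one_neq0 C A).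
HB.instance Definition _ := GRing.Lmodule_isLalgebra.Build C (cstar_sort A)
  (@cstar_mulZl C A).
HB.instance Definition _ := GRing.Lalgebra_isAlgebra.Build C (cstar_sort A)
  (@cstar_mulZr C A).

Definition star (x : A) : A := @cstar_star C A x.

End CStarInstances.

(* H with the inner product ip (linear in the first variable) is a Hilbert
   space. *)
Definition is_hilbert (C : numClosedFieldType) (H : completeNormedModType C)
    (ip : {dot H for (@Num.conj C)}) : Prop :=
  forall x : H, `|x| ^+ 2 = ip x x.

Section CStar.
Variable C : numClosedFieldType.
Implicit Types A TA CT CTA B BB D T W : cstarAlgType C.

Definition unital_starhom A D (f : A -> D) : Prop :=
  [/\ linear f, monoid_morphism f & forall x, f (star x) = star (f x)].

Definition unitary D (u : D) : Prop := star u * u = 1 /\ u * star u = 1.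

(* u ^ n for a unitary u *)
Definition upow D (u : D) (n : int) : D :=
  match n with Posz k => u ^+ k | Negz k => star u ^+ k.+1 end.

Definition star_mx D n (X : 'M[D]_n) : 'M[D]_n := \matrix_(i, j) star (X j i).

Definition positive_mx D n (X : 'M[D]_n) : Prop :=
  exists Y : 'M[D]_n, X = star_mx Y *m Y.

Definition completely_positive A D (f : A -> D) : Prop :=
  forall n (X : 'M[A]_n), positive_mx X -> positive_mx (map_mx f X).

Definition ucp A D (f : A -> D) : Prop :=
  [/\ linear f, f 1 = 1 & completely_positive f].

Definition is_state A (h : A -> C) : Prop :=
  [/\ scalar h, h 1 = 1 & forall x, 0 <= h (star x * x)].

Definition closed_span D (P : set D) : set D :=
  closure [set x | exists n (k : 'I_n -> C) (v : 'I_n -> D),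
    (forall i, P (v i)) /\ x = \sum_i k i *: v i].

(* D is the smallest closed unital *-subalgebra of itself containing s. *)
Definition generates D (s : seq D) : Prop :=
  forall S : set D, closed S -> S 1 ->
    (forall (k : C) x y, S x -> S y -> S (k *: x + y)) ->
    (forall x y, S x -> S y -> S (x * y)) ->
    (forall x, S x -> S (star x)) ->
    (forall x, x \in s -> S x) ->
  forall x, S x.

(* A is the universal unital C*-algebra generated by the list s subject to the
   relations rel. Uniqueness of the map induced by a list of elements satisfying
   rel follows from generates. *)
Definition is_universal (rel : forall D, seq D -> Prop) A (s : seq A) : Prop :=
  [/\ rel A s, generates s &
      forall D (t : seq D), rel D t ->
        exists2 f : A -> D, unital_starhom f & map f s = t].

Definition is_representation A (H : completeNormedModType C)
    (ip : {dot H for (@Num.conj C)}) (pi : A -> H -> H) : Prop :=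
  [/\ (forall a, linear (pi a)),
      (forall a, exists M : C, forall x, `|pi a x| <= M * `|x|),
      (forall (k : C) a b x, pi (k *: a + b) x = k *: pi a x + pi b x),
      (forall x, pi 1 x = x) /\ (forall a b x, pi (a * b) x = pi a (pi b x)) &
      (forall a x y, ip (pi a x) y = ip x (pi (star a) y))].

Definition faithful A (H : Type) (pi : A -> H -> H) : Prop :=
  forall a b, (forall x, pi a x = pi b x) -> a = b.

(* The Hilbert space L with t is the tensor product of H and K. *)
Definition is_hilbert_tensor (H K L : completeNormedModType C)
    (ipH : {dot H for (@Num.conj C)}) (ipK : {dot K for (@Num.conj C)})
    (ipL : {dot L for (@Num.conj C)}) (t : H -> K -> L) : Prop :=
  [/\ (forall y, linear (t ^~ y)), (forall x, linear (t x)),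
      (forall x x' y y', ipL (t x y) (t x' y') = ipH x x' * ipK y y') &
      closure [set z | exists n (x : 'I_n -> H) (y : 'I_n -> K),
        z = \sum_i t (x i) (y i)] = setT].

(* T is the spatial tensor product of A1 and A2, with i1 a = a (x) 1 and
   i2 b = 1 (x) b: for faithful representations pi1 on H1 and pi2 on H2, T acts
   faithfully on the tensor product of H1 and H2, with a (x) b acting as
   pi1 a (x) pi2 b, and is the closed linear span of the a (x) b. *)
Definition is_tensor A1 A2 T (i1 : A1 -> T) (i2 : A2 -> T) : Prop :=
  [/\ unital_starhom i1, unital_starhom i2,
      closed_span [set x | exists a b, x = i1 a * i2 b] = setT &
      exists (H1 H2 L : completeNormedModType C)
        (ip1 : {dot H1 for (@Num.conj C)}) (ip2 : {dot H2 for (@Num.conj C)})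
        (ipL : {dot L for (@Num.conj C)}) (t : H1 -> H2 -> L)
        (pi1 : A1 -> H1 -> H1) (pi2 : A2 -> H2 -> H2) (pi : T -> L -> L),
      [/\ [/\ is_hilbert ip1, is_hilbert ip2 & is_hilbert ipL],
          is_hilbert_tensor ip1 ip2 ipL t,
          [/\ is_representation ip1 pi1, is_representation ip2 pi2
            & is_representation ipL pi],
          [/\ faithful pi1, faithful pi2 & faithful pi] &
          forall a b x y, pi (i1 a * i2 b) (t x y) = t (pi1 a x) (pi2 b y)]].

(* E = h (x) id, resp. id (x) h, on an algebra T containing products
   i1 a * i2 b; used for both the ordinary and the braided tensor product. *)
Definition is_slice_l A1 A2 T (i1 : A1 -> T) (i2 : A2 -> T) (h : A1 -> C)
    (E : T -> A2) : Prop :=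
  ucp E /\ forall a b, E (i1 a * i2 b) = h a *: b.

Definition is_slice_r A1 A2 T (i1 : A1 -> T) (i2 : A2 -> T) (h : A2 -> C)
    (E : T -> A1) : Prop :=
  ucp E /\ forall a b, E (i1 a * i2 b) = h b *: a.

(* h is the Haar state of the compact quantum group (B, Delta), where
   BB = B (x) B has legs j1 and j2. *)
Definition is_haar_state B BB (j1 j2 : B -> BB) (Delta : B -> BB)
    (h : B -> C) : Prop :=
  is_state h /\
  exists El Er : BB -> B,
    [/\ is_slice_l j1 j2 h El, is_slice_r j1 j2 h Er,
        forall b, El (Delta b) = h b *: 1 &
        forall b, Er (Delta b) = h b *: 1].

Definition SUq2_rel (q : C) D (s : seq D) : Prop :=
  if s is [:: a; g] then
    [/\ star a * a + star g * g = 1,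
        a * star a + (`|q| ^+ 2) *: (star g * g) = 1,
        a * g = q^* *: (g * a) &
        g * star g = star g * g]
  else False.

Definition torus_rel (zeta : C) D (s : seq D) : Prop :=
  if s is [:: u; v] then
    [/\ unitary u, unitary v & u * v = zeta *: (v * u)]
  else False.

Definition boson_rel (q zeta : C) D (s : seq D) : Prop :=
  if s is [:: a; g; z] then
    [/\ SUq2_rel q [:: a; g], unitary z,
        z * a * star z = a & z * g * star z = zeta^-1 *: g]
  else False.

(* x is homogeneous of degree n for the coaction rho : A -> CT (x) A, where
   c1, c2 are the legs of CT (x) A and z is the coordinate of the circle. *)
Definition homogeneous CT A CTA (c1 : CT -> CTA) (c2 : A -> CTA)
    (rho : A -> CTA) (z : CT) (n : int) (x : A) : Prop :=
  rho x = c1 (upow z n) * c2 x.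

(* W with the inclusion j into T = (C(T^2_zeta) (x) A) (x) A is the braided
   tensor product of A with itself, and i1, i2 are its two legs. Here
   p1, p2 are the legs of C(T^2_zeta) (x) A, k1, k2 those of T, and
   hom n x says that x is homogeneous of degree n. *)
Definition is_braided_tensor A T2 TA T W (hom : int -> A -> Prop) (U V : T2)
    (p1 : T2 -> TA) (p2 : A -> TA) (k1 : TA -> T) (k2 : A -> T)
    (j : W -> T) (i1 i2 : A -> W) : Prop :=
  [/\ unital_starhom j /\ injective j,
      unital_starhom i1 /\ unital_starhom i2,
      (forall n x, hom n x -> j (i1 x) = k1 (p1 (upow U n) * p2 x)),
      (forall n y, hom n y -> j (i2 y) = k1 (p1 (upow V n)) * k2 y) &
      range j = closed_span [set x | exists a b, x = j (i1 a) * j (i2 b)]].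

Definition circle : set C := [set t | `|t| = 1].

(* ev identifies CT with the *-algebra of continuous functions on the circle
   (functions on the plane are only looked at on the circle); the norm of CT is
   then the supremum norm, since a *-algebra has at most one C*-norm. *)
Definition is_circle_algebra CT (ev : CT -> C -> C) : Prop :=
  [/\ (forall t, circle t ->
        [/\ scalar (ev ^~ t), monoid_morphism (ev ^~ t)
          & forall f, ev (star f) t = (ev f t)^*]),
      (forall f g, {in circle, ev f =1 ev g} -> f = g),
      (forall f, {within circle, continuous (ev f)}) &
      (forall phi : C -> C, {within circle, continuous phi} ->
        exists f, {in circle, ev f =1 phi})].

End CStar.

(* Main.v *)
(* For homogeneous *-polynomials [x], [y] in alpha and gamma, the assignment
   iota1 x * iota2 y |-> x z^(deg y) (x) y carries Delta_A to Delta_B, so slicing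
   Delta_B by the Haar state of B computes the braided slices of Delta_A as soon
   as h_B (x z^m) = 0 for deg x <> 0. That vanishing is the invariance of h_B under
   the gauge automorphisms gamma |-> t gamma of B, which holds by the usual
   uniqueness argument for Haar states. The invariance of h on the dense
   *-algebra of polynomials extends to A because positive functionals are bounded:
   for a self-adjoint x of small norm, 1 - x is a square. Applying this to the
   vector functionals of a faithful representation avoids any norm bound on
   completely positive maps. *)
Require Import Defs.
From mathcomp Require Import all_boot all_order all_algebra.
From mathcomp Require Import complex ring.
From mathcomp Require Import boolp classical_sets reals topology normedtype.

Set Implicit Arguments.
Unset Strict Implicit.
Unset Printing Implicit Defensive.

Import Order.TTheory GRing.Theory Num.Theory.
Import numFieldNormedType.Exports.
Local Open Scope classical_set_scope.
Local Open Scope ring_scope.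

(** * Linear maps and *-homomorphisms *)

Section LinearFun.
Variables (S : pzRingType) (V W : lmodType S) (f : V -> W).
Hypothesis f_lin : linear f.

Lemma linear_funD x y : f (x + y) = f x + f y.
Proof. by have := f_lin 1 x y; rewrite !scale1r. Qed.

Lemma linear_fun0 : f 0 = 0.
Proof. by apply: (addIr (f 0)); rewrite -linear_funD !add0r. Qed.

Lemma linear_funZ k x : f (k *: x) = k *: f x.
Proof. by rewrite -[k *: x]addr0 f_lin linear_fun0 addr0. Qed.

Lemma linear_funB x y : f (x - y) = f x - f y.
Proof. by rewrite linear_funD -scaleN1r linear_funZ scaleN1r. Qed.

Lemma linear_fun_sum I (r : seq I) (P : pred I) (E : I -> V) :
  f (\sum_(i <- r | P i) E i) = \sum_(i <- r | P i) f (E i).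
Proof.
by elim/big_rec2: _ => [|i y z _ <-]; rewrite ?linear_fun0 ?linear_funD.
Qed.

End LinearFun.

Section ScalarFun.
Variables (S : nzRingType) (V : lmodType S) (f : V -> S).
Hypothesis f_lin : scalar f.

Lemma scalar_funD x y : f (x + y) = f x + f y.
Proof. exact: (@linear_funD _ _ S^o). Qed.

Lemma scalar_fun0 : f 0 = 0.
Proof. exact: (@linear_fun0 _ _ S^o). Qed.

Lemma scalar_funZ k x : f (k *: x) = k * f x.
Proof. exact: (@linear_funZ _ _ S^o). Qed.

Lemma scalar_funB x y : f (x - y) = f x - f y.
Proof. exact: (@linear_funB _ _ S^o). Qed.

End ScalarFun.

Section StarAlgebra.
Variables (C : numClosedFieldType) (A : cstarAlgType C).
Implicit Types (x y : A) (k : C).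

Lemma starK x : star (star x) = x. Proof. exact: cstar_starK. Qed.

Lemma starD x y : star (x + y) = star x + star y.
Proof. exact: cstar_starD. Qed.

Lemma starZ k x : star (k *: x) = k^* *: star x.
Proof. exact: cstar_starZ. Qed.

Lemma starM x y : star (x * y) = star y * star x.
Proof. exact: cstar_starM. Qed.

Lemma star1 : star (1 : A) = 1.
Proof. by rewrite -[LHS]mulr1 -[X in _ * X]starK -starM mulr1 starK. Qed.

Lemma star0 : star (0 : A) = 0.
Proof. by apply: (addIr (star 0)); rewrite -starD !add0r. Qed.

Lemma starN x : star (- x) = - star x.
Proof. by rewrite -scaleN1r starZ rmorphN1 scaleN1r. Qed.

Lemma cstar_normrM x y : `|x * y| <= `|x| * `|y|.
Proof. exact: cstar_normM. Qed.

(** The C*-identity gives [|y|^2 = |star y * y| <= |star y| |y|]; applying this to both [x] and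
    [star x] yields equality. *)
Lemma norm_star x : `|star x| = `|x|.
Proof.
suff le y : `|y| <= `|star y|.
  by apply/eqP; rewrite eq_le le andbT -{2}[x]starK le.
have [->|y0] := eqVneq y 0; first by rewrite star0.
have : `|y| ^+ 2 <= `|star y| * `|y|.
  by rewrite -(cstar_norm_star y) cstar_normM.
by rewrite expr2 ler_pM2r // normr_gt0.
Qed.

End StarAlgebra.

Section UnitalStarHom.
Variables (C : numClosedFieldType) (A D : cstarAlgType C) (f : A -> D).
Hypothesis hf : unital_starhom f.

Let f_lin : linear f. Proof. by case: hf. Qed.

Lemma starhomD x y : f (x + y) = f x + f y.
Proof. exact: linear_funD. Qed.

Lemma starhom0 : f 0 = 0.
Proof. exact: linear_fun0. Qed.

Lemma starhomZ k x : f (k *: x) = k *: f x.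
Proof. exact: linear_funZ. Qed.

Lemma starhomB x y : f (x - y) = f x - f y.
Proof. exact: linear_funB. Qed.

Lemma starhomM x y : f (x * y) = f x * f y.
Proof. by case: hf => _ [_ +] _; apply. Qed.

Lemma starhom1 : f 1 = 1.
Proof. by case: hf => _ [+ _] _. Qed.

Lemma starhomS x : f (star x) = star (f x).
Proof. by case: hf. Qed.

End UnitalStarHom.

Lemma unital_starhom_comp (C : numClosedFieldType) (A B D : cstarAlgType C)
    (f : B -> D) (g : A -> B) :
  unital_starhom f -> unital_starhom g -> unital_starhom (f \o g).
Proof.
move=> hf hg; split=> [k x y|| x] /=.
- by rewrite (starhomD hg) (starhomZ hg) (starhomD hf) (starhomZ hf).
- split=> [|x y] /=; first by rewrite (starhom1 hg) (starhom1 hf).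
  by rewrite (starhomM hg) (starhomM hf).
- by rewrite (starhomS hg) (starhomS hf).
Qed.

(** * Closures and epsilon arguments *)

Lemma closureP (C : numFieldType) (V : normedModType C) (P : set V) (v : V) :
  closure P v <-> forall e : C, 0 < e -> exists2 w, P w & `|v - w| < e.
Proof.
split=> [Pv e e0|Pv B /nbhs_ballP[e /= e0 eB]].
  have [w [Pw]] := Pv (ball v e) (nbhsx_ballx v e e0).
  by rewrite -ball_normE /=; exists w.
have [w Pw vw] := Pv e e0; exists w; split=> //; apply: eB.
by rewrite -ball_normE.
Qed.

(* [M] need not be a nonnegative number: this is only known when [V] contains
   a nonzero vector. *)
Lemma closure_bounded_ker (C : numFieldType) (V W : normedModType C)
    (f : V -> W) (M : C) (P : set V) :
  (forall x y, f (x - y) = f x - f y) -> (forall x, `|f x| <= M * `|x|) ->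
  (forall x, P x -> f x = 0) -> forall x, closure P x -> f x = 0.
Proof.
move=> fB fM fP x /closureP Px.
apply/eqP; rewrite -normr_eq0; apply/eqP; case: (eqVneq `|f x| 0) => // fx0.
have fx_gt0 : 0 < `|f x| by rewrite lt_def fx0 normr_ge0.
have M1 : 0 < `|M| + 1 by rewrite ltr_wpDl.
have [y Py xy] := Px (`|f x| / (`|M| + 1)) (divr_gt0 fx_gt0 M1).
have fxE : f x = f (x - y) by rewrite fB (fP y Py) subr0.
(* [M * |x - y|] bounds a norm, so it is nonnegative and coincides with [|M| * |x - y|], whatever
   [M] is. *)
have /(le_trans (fM _)) : M * `|x - y| <= `|M| * `|x - y|.
  have M0 : 0 <= M * `|x - y| by apply: le_trans (fM _); rewrite normr_ge0.
  by rewrite -(ger0_norm M0) normrM normr_id.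
rewrite -fxE => le1.
have : `|M| * `|x - y| <= (`|M| + 1) * `|x - y|.
  by rewrite ler_wpM2r // lerDl.
move=> /(le_trans le1) le2; move: xy; rewrite ltr_pdivlMr // mulrC.
by move=> /(le_lt_trans le2); rewrite ltxx.
Qed.

Lemma normr_le_small (C : numFieldType) (V : normedZmodType C) (K : C) (v : V) :
  0 <= K -> (forall e : C, 0 < e -> `|v| <= K * e) -> v = 0.
Proof.
move=> K0 small; apply/eqP; rewrite -normr_eq0; apply: contraT => v0.
have v_gt0 : 0 < `|v| by rewrite lt_def v0 normr_ge0.
have K1 : 0 < K + 1 by rewrite ltr_wpDl.
have := small (`|v| / (K + 1)) (divr_gt0 v_gt0 K1).
rewrite mulrA ler_pdivlMr // mulrC ler_pM2r //.
by rewrite gerDl ler10.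
Qed.

(** A positive element of [R[i]] has zero imaginary part, so the archimedean property of [R] can be
    applied to its real part. *)
Lemma exp_half_lt (R : realType) (e : R[i]) :
  0 < e -> exists n, 2^-1 ^+ n < e.
Proof.
case: e => r s; rewrite ltcE /= => /andP[/eqP-> r0].
have /= := truncnS_gt r^-1; set n := (Num.truncn r^-1).+1 => rn.
exists n; rewrite -[X in _ < X]/((r%:C)%C).
have -> : 2^-1 ^+ n = ((2^-1 ^+ n)%:C)%C :> R[i].
  by rewrite rmorphXn fmorphV rmorph_nat.
rewrite ltcR exprVn invf_plt ?posrE ?exprn_gt0 //.
by apply: lt_le_trans rn _; rewrite -natrX ler_nat ltnW // ltn_expl.
Qed.

(** * Positive functionals *)

(* [1 - sqrt (1 - x)] is the fixed point of [y |-> (x + y^2) / 2], a contraction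
   of the ball of radius 1/2. *)
Section SquareRoot.
Variables (R : realType) (A : cstarAlgType R[i]) (x : A).
Hypothesis x_small : `|x| <= 3 / 4.

Let phi (y : A) : A := 2^-1 *: (x + y * y).
Let u n : A := iter n phi 0.

Let norm_half (y : A) : `|2^-1 *: y| = 2^-1 * `|y|.
Proof. by rewrite normrZ ger0_norm // invr_ge0. Qed.

Let phi_small (y : A) : `|y| <= 2^-1 -> `|phi y| <= 2^-1.
Proof.
move=> yle; rewrite norm_half -[leRHS]mulr1 ler_pM2l ?invr_gt0 //.
(* The bound 3/4 on [x] and the radius 1/2 fit exactly: [|x + y * y| <= 3/4 + 1/4]. *)
have -> : 1 = 3 / 4 + 2^-1 * 2^-1 :> R[i] by field.
apply: le_trans (ler_normD _ _) (lerD x_small _).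
by apply: le_trans (cstar_normrM _ _) (ler_pM _ _ _ _).
Qed.

Let u_small n : `|u n| <= 2^-1.
Proof.
elim: n => [|n IHn]; last by rewrite /u iterS phi_small.
by rewrite normr0 invr_ge0.
Qed.

(** This splitting of [y * y - z * z] needs no commutativity. On the ball of radius 1/2 it shows
    that [phi] halves distances. *)
Let phiB (y z : A) : phi y - phi z = 2^-1 *: (y * (y - z) + (y - z) * z).
Proof.
rewrite -scalerBr; congr (_ *: _).
by rewrite mulrBr mulrBl addrA subrK opprD addrACA subrr add0r.
Qed.

Let u_contract m n : `|u (n + m)%N - u n| <= 2^-1 ^+ n.
Proof.
elim: n => [|n IHn].
  by rewrite expr0 subr0 (le_trans (u_small _)) // invf_le1 ?ler1n.
rewrite addSn /u !iterS -/(u _) -/(u _) phiB norm_half exprS.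
rewrite ler_pM2l ?invr_gt0 //; set v := u (n + m)%N - u n.
apply: le_trans (ler_normD _ _) _.
have -> : 2^-1 ^+ n = 2^-1 * 2^-1 ^+ n + 2^-1 ^+ n * 2^-1 :> R[i] by field.
by rewrite lerD // (le_trans (cstar_normrM _ _)) // ler_pM.
Qed.

(** Two consecutive iterates are controlled at the same index, so that [u n.+1 = phi (u n)] can be
    compared with both [l] and [phi l]. *)
Let u_limit : exists l, forall e : R[i], 0 < e ->
  exists n, `|l - u n| < e /\ `|l - u n.+1| < e.
Proof.
have : cvg (u @ \oo).
  apply/cauchy_cvgP/cauchy_exP => e e0.
  have [N Ne] := exp_half_lt e0.
  exists (u N); exists N => //= n /subnKC <-.
  by rewrite -ball_normE /= distrC (le_lt_trans (u_contract _ _)).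
move=> /cvg_ex[l ul]; exists l => e e0.
have /cvgrPdist_lt/(_ e e0)[N _ Ne] := ul.
by exists N; split; apply: Ne => /=.
Qed.

Lemma cstar_sqrt : star x = x ->
  exists y : A, star y = y /\ (1 - y) * (1 - y) = 1 - x.
Proof.
move=> xx; have u_star n : star (u n) = u n.
  elim: n => [|n IHn]; first exact: star0.
  rewrite /u iterS -/(u n) starZ starD starM xx IHn; congr (_ *: _).
  by rewrite fmorphV rmorph_nat.
have [l lim_l] := u_limit; exists l; split.
  apply/eqP; rewrite -subr_eq0; apply/eqP.
  apply: (@normr_le_small _ _ 2) => // e /lim_l[n [le _]].
  have -> : star l - l = star (l - u n) - (l - u n).
    by rewrite starD starN u_star opprB addrA subrK.
  apply: le_trans (ler_normB _ _) _; rewrite norm_star mulr_natl mulr2n.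
  by apply/ltW/ltrD.
(* The fixed point equation [l = phi l], doubled; completing the square turns it into the claim. *)
suff phi_l : l + l = x + l * l.
  have -> : x = l + l - l * l by rewrite phi_l addrK.
  rewrite mulrBr mulr1 mulrBl mul1r !opprB opprD -addrA; congr (1 + _).
  by rewrite addrCA.
have -> : l + l = 2 *: l by rewrite scaler_nat mulr2n.
suff lE : l = phi l by rewrite {1}lE scalerA divff ?pnatr_eq0 // scale1r.
apply/eqP; rewrite -subr_eq0; apply/eqP.
have K0 : 0 <= `|l| + 2 by rewrite addr_ge0.
(* In the constant, 1 accounts for [l - u n.+1] and [|l| + 1] for [phi (u n) - phi l], estimated
   through [phiB]. *)
apply: (@normr_le_small _ _ (`|l| + 2)) => // e /lim_l[n [le le1]].
have -> : l - phi l = (l - u n.+1) + (phi (u n) - phi l).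
  by rewrite addrA subrK.
apply: le_trans (ler_normD _ _) _.
rewrite phiB norm_half.
have : `|u n * (u n - l) + (u n - l) * l| <= (`|l| + 2^-1) * e.
  apply: le_trans (ler_normD _ _) _; rewrite [leLHS]addrC [leRHS]mulrDl.
  apply: lerD; apply: le_trans (cstar_normrM _ _) _.
    by rewrite [leRHS]mulrC ler_pM // distrC ltW.
  by rewrite ler_pM // distrC ltW.
move=> le2; have : 2^-1 * `|u n * (u n - l) + (u n - l) * l| <= (`|l| + 1) * e.
  rewrite -[leRHS]mul1r; apply: ler_pM => //; first by rewrite invr_ge0.
    by rewrite invf_le1 // ler1n.
  apply: (le_trans le2); rewrite ler_pM2r; last exact: le_lt_trans le.
  by rewrite lerD2l invf_le1 ?ler1n.
move=> /(lerD (ltW le1))/le_trans; apply.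
by rewrite -{1}[e]mul1r -mulrDl addrCA -[1 + 1]/2.
Qed.

End SquareRoot.

Section PositiveFunctional.
Variables (R : realType) (A : cstarAlgType R[i]) (phi : A -> R[i]).
Hypotheses (phi_linear : scalar phi) (phi_pos : forall x, 0 <= phi (star x * x)).

Let phiD := scalar_funD phi_linear.
Let phiZ := scalar_funZ phi_linear.

Let phi1_ge0 : 0 <= phi 1.
Proof. by have := phi_pos 1; rewrite star1 mulr1. Qed.

(** By [cstar_sqrt], [1 - x] is the square of a self-adjoint element, so [phi (1 - x)] is
    nonnegative. *)
Let phi_le1 x : star x = x -> `|x| <= 3 / 4 -> phi x <= phi 1.
Proof.
move=> xx x_small; have [y [yy y2]] := cstar_sqrt x_small xx.
have := phi_pos (1 - y).
by rewrite starD starN star1 yy y2 phiD -scaleN1r phiZ mulN1r subr_ge0.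
Qed.

(** The previous bound is used for [x] and [- x]; it also shows that [phi x] is real, being
    comparable to the real number [phi 1]. *)
Let phi_norm_le1 x : star x = x -> `|x| <= 3 / 4 -> `|phi x| <= phi 1.
Proof.
move=> xx x_small; have le1 := phi_le1 xx x_small.
have geN1 : - phi x <= phi 1.
  by rewrite -mulN1r -phiZ scaleN1r phi_le1 ?normrN // starN xx.
rewrite real_ler_norml ?le1 ?andbT 1?lerNl //.
by rewrite (ler_real le1) ger0_real.
Qed.

(** Rescaled to norm 3/4, [a] becomes [b = x + 'i *: y] with self-adjoint [x] and [y] of norm at
    most 3/4. Hence [|phi b| <= 2 * phi 1], and scaling back costs the factor [4 / 3 * |a|]. *)
Lemma positive_functional_bounded a : `|phi a| <= 8 / 3 * phi 1 * `|a|.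
Proof.
have [->|a0] := eqVneq a 0; first by rewrite (scalar_fun0 phi_linear) !normr0 mulr0.
have a_gt0 : 0 < `|a| by rewrite normr_gt0.
pose b := (3 / 4 / `|a|) *: a.
have nb : `|b| = 3 / 4.
  by rewrite normrZ ger0_norm ?divr_ge0 // divfK ?normr_eq0.
pose x := 2^-1 *: (b + star b); pose y := (- 'i / 2) *: (b - star b).
have conj2 : 2^-1^* = 2^-1 :> R[i] by rewrite fmorphV rmorph_nat.
have bE : b = x + 'i *: y.
  rewrite scalerA mulrA mulrN -expr2 sqrCi opprK mul1r -scalerDr.
  have bb : b + b = 2 *: b by rewrite scaler_nat mulr2n.
  by rewrite addrACA subrr addr0 bb scalerA mulVf ?scale1r ?pnatr_eq0.
have xx : star x = x by rewrite starZ conj2 starD starK addrC.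
have yy : star y = y.
  rewrite starZ rmorphM rmorphN /= conjCi conj2 starD starN starK.
  by rewrite opprK -opprB scalerN -scaleNr -mulNr.
have small (k : R[i]) (c : A) : `|k| = 2^-1 -> `|c| <= `|b| + `|b| ->
    `|k *: c| <= 3 / 4.
  move=> kE; rewrite nb (normrZ k c) kE => cle.
  have -> : 3 / 4 = 2^-1 * (3 / 4 + 3 / 4) :> R[i] by field.
  by rewrite ler_pM2l ?invr_gt0.
have x_small : `|x| <= 3 / 4.
  apply: small; first by rewrite ger0_norm ?invr_ge0.
  by rewrite -[X in _ <= _ + X]norm_star ler_normD.
have y_small : `|y| <= 3 / 4.
  apply: small; last by rewrite -[X in _ <= _ + X]norm_star ler_normB.
  by rewrite normrM normrN normCi mul1r ger0_norm ?invr_ge0.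
have phib : `|phi b| <= phi 1 + phi 1.
  rewrite {1}bE phiD (phiZ 'i y); apply: le_trans (ler_normD _ _) (lerD _ _).
    exact: phi_norm_le1.
  by rewrite normrM normCi mul1r phi_norm_le1.
have aE : a = (4 / 3 * `|a|) *: b.
  rewrite scalerA; suff -> : 4 / 3 * `|a| * (3 / 4 / `|a|) = 1.
    by rewrite scale1r.
  by field; rewrite normr_eq0.
rewrite {1}aE phiZ normrM ger0_norm ?mulr_ge0 ?invr_ge0 //.
have -> : 8 / 3 * phi 1 * `|a| = 4 / 3 * `|a| * (phi 1 + phi 1) by field.
by rewrite ler_wpM2l ?mulr_ge0 ?invr_ge0.
Qed.

End PositiveFunctional.

(** * Hilbert space representations and tensor products *)

Section DotProduct.
Variables (C : numClosedFieldType) (H : lmodType C).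
Variable ip : {dot H for (@Num.conj C)}.

Lemma dotDl x y z : ip (x + y) z = ip x z + ip y z.
Proof. exact: linearDl. Qed.

Lemma dotDr x y z : ip x (y + z) = ip x y + ip x z.
Proof. exact: linearDr. Qed.

Lemma dotZl k x y : ip (k *: x) y = k * ip x y.
Proof. exact: linearZl_LR. Qed.

Lemma dotZr k x y : ip x (k *: y) = k^* * ip x y.
Proof. exact: linearZr_LR. Qed.

Lemma dotBl x y z : ip (x - y) z = ip x z - ip y z.
Proof. exact: linearBl. Qed.

End DotProduct.

Section Representation.
Variables (C : numClosedFieldType) (D : cstarAlgType C).
Variables (H : completeNormedModType C) (ip : {dot H for (@Num.conj C)}).
Variable pi : D -> H -> H.
Hypotheses (hilb : is_hilbert ip) (hpi : is_representation ip pi).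

(** Polarization over the complex numbers: comparing the identity [pol] at [T xi] and at
    ['i *: T xi] leaves [2 * ip (T xi) (T xi) = 0]. *)
Lemma quadratic_form_eq0 (T : H -> H) :
  linear T -> (forall xi, ip (T xi) xi = 0) -> forall xi, T xi = 0.
Proof.
move=> T_lin T0 xi.
have [TD TZ] := (linear_funD T_lin, linear_funZ T_lin).
have pol x y : ip (T x) y + ip (T y) x = 0.
  have := T0 (x + y).
  by rewrite TD dotDl !dotDr !T0 add0r addr0 => <-.
have := pol xi ('i *: T xi); rewrite TZ dotZl dotZr conjCi.
rewrite mulNr addrC => /eqP; rewrite subr_eq0 => /eqP/(mulfI (neq0Ci _)) eq1.
have := pol xi (T xi); rewrite eq1 -mulr2n => /eqP.
rewrite mulrn_eq0 /= -hilb expf_eq0 /= normr_eq0 => /eqP //.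
Qed.

Lemma rep0 x : pi 0 x = 0.
Proof.
case: hpi => _ _ piP _ _.
by apply: (addIr (pi 0 x)); rewrite -{1}[pi 0 x]scale1r -piP scale1r !add0r.
Qed.

Lemma repD a b x : pi (a + b) x = pi a x + pi b x.
Proof. by case: hpi => _ _ + _ _; move/(_ 1 a b x); rewrite !scale1r. Qed.

Lemma repZ k a x : pi (k *: a) x = k *: pi a x.
Proof.
by case: hpi => _ _ + _ _; move/(_ k a 0 x); rewrite rep0 !addr0.
Qed.

Lemma repB a b x : pi (a - b) x = pi a x - pi b x.
Proof. by rewrite repD -scaleN1r repZ scaleN1r. Qed.

Lemma rep1 x : pi 1 x = x.
Proof. by case: hpi => _ _ _ [+ _] _. Qed.

Lemma repM a b x : pi (a * b) x = pi a (pi b x).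
Proof. by case: hpi => _ _ _ [_ +] _. Qed.

Lemma rep_star a x y : ip (pi a x) y = ip x (pi (star a) y).
Proof. by case: hpi. Qed.

Lemma rep_pos a x : 0 <= ip (pi (star a * a) x) x.
Proof.
by rewrite repM rep_star starK -hilb exprn_ge0.
Qed.

(** Represented elements act as bounded operators, hence are determined on a dense set of
    vectors. *)
Lemma rep_vec_ext (a b : D) (P : set H) : closure P = setT ->
  (forall x, P x -> pi a x = pi b x) -> faithful pi -> a = b.
Proof.
move=> PT pi_eq fth; apply: fth => x.
case: hpi => /(_ (a - b)) pi_lin /(_ (a - b))[M piM] _ _ _.
have := @closure_bounded_ker _ _ _ (pi (a - b)) M P _ piM.
move=> /(_ _ _ x); rewrite PT => ker.
apply: subr0_eq; rewrite -repB ker // => [y z|y Py].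
  exact: linear_funB.
by rewrite repB pi_eq ?subrr.
Qed.

End Representation.

(** For each vector [xi], both [x |-> ip (pi (F x) xi) xi] and [h] are positive functionals, hence
    bounded, so their relation on [P] passes to the closure. An operator with zero quadratic form is
    zero, and faithfulness concludes. *)
Lemma positive_map_scalar (R : realType) (A D : cstarAlgType R[i])
    (H : completeNormedModType R[i]) (ip : {dot H for (@Num.conj R[i])})
    (pi : D -> H -> H) (F : A -> D) (h : A -> R[i]) (P : set A) :
  is_hilbert ip -> is_representation ip pi -> faithful pi ->
  linear F -> (forall x, exists w, F (star x * x) = star w * w) ->
  scalar h -> (forall x, 0 <= h (star x * x)) ->
  closure P = setT -> (forall x, P x -> F x = h x *: 1) ->
  forall x, F x = h x *: 1.
Proof.
move=> hilb hpi fth F_lin F_pos h_lin h_pos PT FP a; apply: fth => xi.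
rewrite (repZ hpi) (rep1 hpi); apply: subr0_eq.
move: xi; apply: (quadratic_form_eq0 hilb) => [k x y|xi].
  case: hpi => pi_lin _ _ _ _.
  by rewrite pi_lin scalerBr [in RHS]addrACA -opprD scalerDr !scalerA mulrC.
pose phi x := ip (pi (F x) xi) xi.
have phi_lin : scalar phi.
  by move=> k x y; rewrite /phi F_lin (repD hpi) (repZ hpi) dotDl dotZl.
have phi_pos x : 0 <= phi (star x * x).
  by rewrite /phi; have [w ->] := F_pos x; exact: rep_pos.
(* The type [R[i]^o] presents the scalars as a normed module over themselves, as
   [closure_bounded_ker] expects. *)
pose f (x : A) : R[i]^o := phi x - h x * ip xi xi.
have : f a = 0.
  apply: (@closure_bounded_ker _ A R[i]^o f
    (8 / 3 * phi 1 + 8 / 3 * h 1 * ip xi xi) P) => [x y|x|x|]; last by rewrite PT.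
  - by rewrite /f (scalar_funB phi_lin) (scalar_funB h_lin); ring.
  - rewrite mulrDl; apply: le_trans (ler_normB _ _) (lerD _ _).
      exact: positive_functional_bounded.
    rewrite normrM [`|ip xi xi|]ger0_norm ?dnorm_ge0 // mulrAC.
    by rewrite ler_wpM2r ?dnorm_ge0 // positive_functional_bounded.
  - move=> Px; rewrite /f /phi FP // (repZ hpi) (rep1 hpi) dotZl.
    exact: subrr.
by rewrite /f /phi dotBl dotZl.
Qed.

Section TensorLegs.
Variables (C : numClosedFieldType) (A1 A2 T : cstarAlgType C).
Variables (i1 : A1 -> T) (i2 : A2 -> T).
Hypothesis tens : is_tensor i1 i2.

Lemma tensor_legl : unital_starhom i1. Proof. by case: tens. Qed.
Lemma tensor_legr : unital_starhom i2. Proof. by case: tens. Qed.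

(** In the given faithful representation the legs act on different tensor factors, so they commute
    on elementary tensors, whose sums are dense. *)
Lemma tensor_leg_comm a b : i1 a * i2 b = i2 b * i1 a.
Proof.
case: tens => h1 h2 _ [H1 [H2 [L [ip1 [ip2 [ipL [t [pi1 [pi2 [pi]]]]]]]]]].
case=> _ [tl tr _ dense] [r1 r2 rL] [_ _ fth] piE.
apply: (rep_vec_ext rL dense) fth => _ [n [x [y ->]]].
have pi_sum c : pi c (\sum_i t (x i) (y i)) = \sum_i pi c (t (x i) (y i)).
  by apply: linear_fun_sum; case: rL.
rewrite !pi_sum; apply: eq_bigr => i _; rewrite piE (repM rL).
have -> u v : pi (i1 a) (t u v) = t (pi1 a u) v.
  by rewrite -[i1 a]mulr1 -(starhom1 h2) piE (rep1 r2).
have -> u v : pi (i2 b) (t u v) = t u (pi2 b v).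
  by rewrite -[i2 b]mul1r -(starhom1 h1) piE (rep1 r1).
by [].
Qed.

(** For a fixed vector [x != 0], the norm of [t x y] is [|x| * |y|], so the action of [i2 a] on the
    vectors [t x y] determines [pi2 a]. *)
Lemma tensor_legr_inj : injective i2.
Proof.
case: tens => h1 h2 _ [H1 [H2 [L [ip1 [ip2 [ipL [t [pi1 [pi2 [pi]]]]]]]]]].
case=> [[hb1 hb2 hbL]] [_ tr tip _] [r1 r2 rL] [f1 f2 fth] piE a b eq_ab.
apply: f2 => y; apply/eqP; rewrite -subr_eq0.
(* If [H1] were zero, the faithful [pi1] would identify 1 with 0 in [A1]. *)
have [x x0] : exists x : H1, x != 0.
  apply: contrapT => H1_0; have /eqP[] := oner_neq0 A1.
  apply: f1 => x; have x0 : x = 0.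
    by apply/eqP; apply/negPn/negP => ?; apply: H1_0; exists x.
  by rewrite (rep1 r1) (rep0 r1).
have tE : t x (pi2 a y) = t x (pi2 b y).
  by rewrite -[x in LHS](rep1 r1) -[x in RHS](rep1 r1) -!piE eq_ab.
have : ipL (t x (pi2 a y - pi2 b y)) (t x (pi2 a y - pi2 b y)) = 0.
  have -> : t x (pi2 a y - pi2 b y) = 0.
    by rewrite (linear_funB (tr x)) tE subrr.
  by rewrite linear0l.
rewrite tip => /eqP; rewrite mulf_eq0 -hb1 -hb2 !expf_eq0 /= !normr_eq0.
by rewrite (negPf x0).
Qed.

End TensorLegs.

(** * Homogeneous polynomials *)

(** The algebraic operations are continuous, so the closure of [P] is one of the closed
    *-subalgebras quantified over in [generates]. *)
Lemma generates_dense (C : numClosedFieldType) (A : cstarAlgType C) (s : seq A)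
    (P : set A) :
  generates s -> P 1 -> (forall k x y, P x -> P y -> P (k *: x + y)) ->
  (forall x y, P x -> P y -> P (x * y)) -> (forall x, P x -> P (star x)) ->
  (forall x, x \in s -> P x) -> closure P = setT.
Proof.
move=> gen P1 PL PM PS Ps; apply/seteqP; split=> // x _; move: x.
apply: gen => [|||||x xs]; try exact: closed_closure.
- exact: subset_closure.
- move=> k x y /closureP Px /closureP Py; apply/closureP => e e0.
  have k1 : 0 < `|k| + 1 by rewrite ltr_wpDl.
  have [x' Px' xx'] := Px (e / (`|k| + 1)) (divr_gt0 e0 k1).
  have e'0 : 0 < e - `|k| * (e / (`|k| + 1)).
    have -> : e - `|k| * (e / (`|k| + 1)) = e / (`|k| + 1).
      by field; rewrite gt_eqF.
    exact: divr_gt0.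
  have [y' Py' yy'] := Py _ e'0.
  exists (k *: x' + y'); first exact: PL.
  rewrite opprD addrACA -scalerBr; apply: le_lt_trans (ler_normD _ _) _.
  rewrite -[ltRHS](subrK (`|k| * (e / (`|k| + 1)))) [ltLHS]addrC.
  by rewrite ltr_leD // normrZ ler_wpM2l // ltW.
- move=> x y /closureP Px /closureP Py; apply/closureP => e e0.
  have e2 : 0 < e / 2 by rewrite divr_gt0.
  have y1 : 0 < `|y| + 1 by rewrite ltr_wpDl.
  have [x' Px' xx'] := Px (e / 2 / (`|y| + 1)) (divr_gt0 e2 y1).
  have x1 : 0 < `|x'| + 1 by rewrite ltr_wpDl.
  (* [y'] is chosen after [x'], since its tolerance depends on [|x'|]. *)
  have [y' Py' yy'] := Py (e / 2 / (`|x'| + 1)) (divr_gt0 e2 x1).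
  exists (x' * y'); first exact: PM.
  have -> : x * y - x' * y' = (x - x') * y + x' * (y - y').
    by rewrite mulrBl mulrBr addrA subrK.
  have -> : e = e / 2 + e / 2 by field.
  apply: le_lt_trans (ler_normD _ _) (ltrD _ _).
    apply: le_lt_trans (cstar_normrM _ _) _.
    rewrite -[ltRHS](divfK (lt0r_neq0 y1)).
    apply: le_lt_trans (_ : `|x - x'| * (`|y| + 1) < _).
      by rewrite ler_wpM2l // lerDl.
    by rewrite ltr_pM2r.
  apply: le_lt_trans (cstar_normrM _ _) _.
  rewrite -[ltRHS](divfK (lt0r_neq0 x1)) mulrC.
  apply: le_lt_trans (_ : `|y - y'| * (`|x'| + 1) < _).
    by rewrite ler_wpM2l // lerDl.
  by rewrite ltr_pM2r.
- move=> x /closureP Px; apply/closureP => e /Px[x' Px' xx'].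
  by exists (star x'); [exact: PS|rewrite -starN -starD norm_star].
- exact/subset_closure/Ps.
Qed.

(** * Integer powers of unitaries *)

Section UnitaryPowers.
Variables (C : numClosedFieldType) (D : cstarAlgType C).
Implicit Types (u v x : D) (m n : int).

Lemma unitary_star u : unitary u -> unitary (star u).
Proof. by case=> h1 h2; split; rewrite starK. Qed.

Lemma upow0 u : upow u 0 = 1. Proof. exact: expr0. Qed.

Lemma upow1 u : upow u 1 = u. Proof. exact: expr1. Qed.

Lemma upowS u n : unitary u -> upow u (n + 1) = u * upow u n.
Proof.
case=> _ uu; case: n => [n|[|n]].
- by rewrite -PoszD addn1 /= exprS.
- by rewrite [Negz 0 + 1]addrC subrr upow0 /= expr1 uu.
- by rewrite NegzE -addn1 PoszD opprD subrK -NegzE /= [in RHS]exprS mulrA uu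
    mul1r addn0.
Qed.

Lemma upowP u n : unitary u -> upow u (n - 1) = star u * upow u n.
Proof.
by move=> uu; rewrite -{2}[n](subrK 1) upowS // mulrA (proj1 uu) mul1r.
Qed.

Lemma upowD u m n : unitary u -> upow u (m + n) = upow u m * upow u n.
Proof.
move=> uu; elim/int_rect: m => [|m IHm|m IHm].
- by rewrite add0r upow0 mul1r.
- by rewrite -addn1 PoszD addrAC !upowS // IHm mulrA.
- by rewrite -addn1 PoszD opprD addrAC !upowP // IHm mulrA.
Qed.

Lemma upow_star u n : star (upow u n) = upow u (- n).
Proof.
have starX v k : star (v ^+ k) = star v ^+ k.
  by elim: k => [|k IHk]; rewrite ?star1 // exprS exprSr starM IHk.
case: n => [[|n]|n]; first by rewrite oppr0 upow0 star1.
- by rewrite -NegzE /= starX.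
- by rewrite NegzE opprK /= starX starK.
Qed.

Lemma upow_unitary u n : unitary u -> unitary (upow u n).
Proof.
by move=> uu; split; rewrite upow_star -upowD // ?addNr ?subrr upow0.
Qed.

Lemma upow_comm u x (k : C) n : unitary u -> k != 0 -> u * x = k *: (x * u) ->
  upow u n * x = k ^ n *: (x * upow u n).
Proof.
move=> uu k0 ux; elim/int_rect: n => [|n IHn|n IHn].
- by rewrite upow0 mul1r mulr1 expr0z scale1r.
- rewrite -addn1 PoszD upowS // -mulrA IHn -scalerAr [in LHS]mulrA ux -scalerAl.
  by rewrite scalerA -[x * u * _]mulrA expfzDr ?expr1z.
- rewrite -addn1 PoszD opprD upowP // -mulrA IHn -scalerAr.
  (* Multiplying [u * x = k *: (x * u)] by [star u] on both sides gives the commutation with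
     [star u], with factor [k^-1]. *)
  have -> : star u * (x * upow u (- n%:Z)) = k^-1 *: (x * (star u * upow u (- n%:Z))).
    rewrite !mulrA scalerAl; congr (_ * _).
    apply: (@scalerI _ _ k k0); rewrite scalerA mulfV // scale1r.
    rewrite -[LHS]mulr1 -(proj2 uu) mulrA -scalerAl -[star u * x * u]mulrA scalerAr.
    by rewrite -ux !mulrA (proj1 uu) mul1r.
  by rewrite scalerA expfzDr.
Qed.

Lemma unitary_comm_star u x : unitary u -> u * x = x * u ->
  star u * x = x * star u.
Proof.
move=> [u1 u2] ux; rewrite -[LHS]mulr1 -u2 mulrA -[star u * x * u]mulrA -ux.
by rewrite !mulrA u1 mul1r.
Qed.

End UnitaryPowers.

Lemma starhom_unitary (C : numClosedFieldType) (A D : cstarAlgType C)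
    (f : A -> D) u : unital_starhom f -> unitary u -> unitary (f u).
Proof.
move=> hf [u1 u2]; split; rewrite -(starhomS hf) -(starhomM hf).
  by rewrite u1 (starhom1 hf).
by rewrite u2 (starhom1 hf).
Qed.

Lemma starhom_upow (C : numClosedFieldType) (A D : cstarAlgType C)
    (f : A -> D) u n : unital_starhom f -> f (upow u n) = upow (f u) n.
Proof.
move=> hf; have fX x k : f (x ^+ k) = f x ^+ k.
  elim: k => [|k IHk]; first by rewrite !expr0 (starhom1 hf).
  by rewrite !exprS (starhomM hf) IHk.
by case: n => n /=; rewrite fX // (starhomS hf).
Qed.

Lemma scalar_unitary (C : numClosedFieldType) (D : cstarAlgType C) (t : C) :
  `|t| = 1 -> unitary (t *: 1 : D).
Proof.
move=> t1; rewrite /unitary starZ star1 -!scalerAl !mul1r !scalerA.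
by rewrite [t^* * t]mulrC -normCK t1 expr1n scale1r.
Qed.

Lemma upow_scalar (C : numClosedFieldType) (D : cstarAlgType C) (t : C) n :
  `|t| = 1 -> upow (t *: 1 : D) n = t ^ n *: 1.
Proof.
move=> t1; have t0 : t != 0 by rewrite -normr_eq0 t1 oner_neq0.
have tC : t^* = t^-1 by rewrite invC_norm t1 expr1n invr1 mul1r.
case: n => n; rewrite /= ?starZ ?star1 exprZn expr1n ?tC //.
by rewrite exprVn.
Qed.

Lemma upowM_comm (C : numClosedFieldType) (D : cstarAlgType C) (u v : D) n :
  u * v = v * u -> upow (u * v) n = upow u n * upow v n.
Proof.
move=> uv; case: n => n /=; first exact: exprMn_comm.
have vu : star v * star u = star u * star v by rewrite -!starM uv.
by rewrite starM vu exprMn_comm.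
Qed.

(** A root of -1 of order [|n|] works: it has modulus 1, and its [n]-th power is -1 for either sign
    of [n]. *)
Lemma circle_expz_neq1 (C : numClosedFieldType) (n : int) :
  n != 0 -> exists2 t : C, `|t| = 1 & t ^ n != 1.
Proof.
have N1 : -1 != 1 :> C by rewrite eq_sym -subr_eq0 opprK -mulr2n pnatr_eq0.
have root k : exists2 t : C, `|t| = 1 & t ^+ k.+1 = -1.
  exists (k.+1.-root (-1)); last exact: rootCK.
  apply/eqP; rewrite -(@pexpr_eq1 _ _ k.+1) //.
  by rewrite -normrX rootCK // normrN1.
case: n => [[//|k]|k] _; have [t t1 tk] := root k; exists t => //.
  by rewrite -exprnP tk.
by rewrite NegzE -exprnN tk invrN1.
Qed.

(** The unitary [w] cancels in [star g * g] and [g * star g] and passes through [a]. This yields the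
    maps out of [B] that multiply [gamma] by a phase or by [p1 V]. *)
Lemma SUq2_rel_twist (C : numClosedFieldType) (q : C) (D : cstarAlgType C)
    (a g w : D) : unitary w -> w * a = a * w -> w * g = g * w ->
  SUq2_rel q [:: a; g] -> SUq2_rel q [:: a; w * g].
Proof.
move=> uw wa wg [r1 r2 r3 r4].
have e1 : star (w * g) * (w * g) = star g * g.
  by rewrite starM -mulrA [star w * _]mulrA (proj1 uw) mul1r.
split; rewrite ?e1 //.
  by rewrite mulrA -wa -mulrA r3 -scalerAr mulrA.
have wsg : w * star g = star g * w.
  have := unitary_comm_star uw wg => /(congr1 (@star C D)).
  by rewrite !starM starK.
by rewrite wg starM -mulrA [w * _]mulrA (proj2 uw) mul1r.
Qed.

Section HomogeneousPolynomials.
Variables (C : numClosedFieldType) (A : cstarAlgType C) (alpha gamma : A).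

(** The degree is recorded by the way [x] is built, so that facts about homogeneous elements follow
    by induction; 0 has every degree. *)
Inductive hpoly : int -> A -> Prop :=
| hpoly0 n : hpoly n 0
| hpoly1 : hpoly 0 1
| hpoly_alpha : hpoly 0 alpha
| hpoly_gamma : hpoly 1 gamma
| hpolyD n x y of hpoly n x & hpoly n y : hpoly n (x + y)
| hpolyZ n k x of hpoly n x : hpoly n (k *: x)
| hpolyM m n x y of hpoly m x & hpoly n y : hpoly (m + n) (x * y)
| hpoly_star n x of hpoly n x : hpoly (- n) (star x).

(** As [w] commutes with the image of [g], the relation [f x = w^n g x] is stable under products and
    adjoints. It serves for the coaction ([w = c1 z]), conjugation by [zB], the gauge maps, and the
    map of [B] into [TA] ([w = p1 V]). *)
Lemma hpoly_twist (D : cstarAlgType C) (f g : A -> D) (w : D) :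
  unital_starhom f -> unital_starhom g -> unitary w ->
  (forall x, w * g x = g x * w) ->
  f alpha = g alpha -> f gamma = w * g gamma ->
  forall n x, hpoly n x -> f x = upow w n * g x.
Proof.
move=> hf hg uw wg fa fg.
have comm n x : upow w n * g x = g x * upow w n.
  rewrite (@upow_comm _ _ w (g x) 1) ?oner_neq0 ?wg ?scale1r //.
  by rewrite exp1rz scale1r.
move=> n x; elim=> {n x}.
- by move=> n; rewrite (starhom0 hf) (starhom0 hg) mulr0.
- by rewrite (starhom1 hf) (starhom1 hg) upow0 mulr1.
- by rewrite upow0 mul1r.
- by rewrite upow1.
- by move=> n x y _ IHx _ IHy; rewrite (starhomD hf) (starhomD hg) mulrDr IHx IHy.
- by move=> n k x _ IHx; rewrite (starhomZ hf) (starhomZ hg) -scalerAr IHx.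
- move=> m n x y _ IHx _ IHy; rewrite (starhomM hf) (starhomM hg) IHx IHy.
  by rewrite upowD // -!mulrA; congr (_ * _); rewrite !mulrA comm.
- move=> n x _ IHx; rewrite (starhomS hf) IHx starM upow_star -(starhomS hg).
  by rewrite comm.
Qed.

Inductive hpoly_span : A -> Prop :=
| hpoly_span0 : hpoly_span 0
| hpoly_spanD n x y of hpoly n x & hpoly_span y : hpoly_span (x + y).

Lemma hpoly_in_span n x : hpoly n x -> hpoly_span x.
Proof. by move=> hx; rewrite -[x]addr0; apply: hpoly_spanD hx hpoly_span0. Qed.

Lemma hpoly_span_dense : generates [:: alpha; gamma] -> closure hpoly_span = setT.
Proof.
have spanD x y : hpoly_span x -> hpoly_span y -> hpoly_span (x + y).
  move=> hx hy; elim: hx => [|n x' y' hx' _ IH]; first by rewrite add0r.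
  by rewrite -addrA; apply: hpoly_spanD hx' IH.
move/generates_dense; apply.
- exact: hpoly_in_span hpoly1.
- move=> k x y hx; apply: spanD; elim: hx => [|n x' y' hx' _ IH].
    by rewrite scaler0; apply: hpoly_span0.
  by rewrite scalerDr; exact: hpoly_spanD (hpolyZ k hx') IH.
- move=> x y hx hy; elim: hx => [|m x' y' hx' _ IH].
    by rewrite mul0r; apply: hpoly_span0.
  rewrite mulrDl; apply: spanD IH; elim: hy => [|n x'' y'' hx'' _ IH].
    by rewrite mulr0; apply: hpoly_span0.
  by rewrite mulrDr; exact: hpoly_spanD (hpolyM hx' hx'') IH.
- move=> x; elim=> [|n x' y' hx' _ IH]; first by rewrite star0; left.
  by rewrite starD; exact: hpoly_spanD (hpoly_star hx') IH.
- move=> x; rewrite !inE => /orP[]/eqP->.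
    exact: hpoly_in_span hpoly_alpha.
  exact: hpoly_in_span hpoly_gamma.
Qed.

End HomogeneousPolynomials.

(** * Invariance on polynomials *)

Section Invariance.
Variables (C : numClosedFieldType) (q zeta : C).
Hypothesis zeta0 : zeta != 0.
Variables (A : cstarAlgType C) (alpha gamma : A).
Local Notation hpoly := (hpoly alpha gamma).

Variables (AA : cstarAlgType C) (iota1 iota2 : A -> AA).
Hypotheses (hi1 : unital_starhom iota1) (hi2 : unital_starhom iota2).
Hypothesis braid : forall n m x y, hpoly n x -> hpoly m y ->
  iota2 y * iota1 x = zeta ^ (- (n * m)) *: (iota1 x * iota2 y).
Variable DeltaA : A -> AA.
Hypothesis hDA : unital_starhom DeltaA.
Hypothesis DA_alpha : DeltaA alpha = iota1 alpha * iota2 alpha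
  - q *: (iota1 (star gamma) * iota2 gamma).
Hypothesis DA_gamma : DeltaA gamma = iota1 gamma * iota2 alpha
  + iota1 (star alpha) * iota2 gamma.

Variables (B : cstarAlgType C) (z : B) (kappa : A -> B).
Hypotheses (uz : unitary z) (hk : unital_starhom kappa).
Hypothesis z_kappa : forall n x, hpoly n x ->
  z * kappa x = zeta ^ (- n) *: (kappa x * z).
Variables (BB : cstarAlgType C) (b1 b2 : B -> BB).
Hypotheses (hb1 : unital_starhom b1) (hb2 : unital_starhom b2).
Hypothesis b12 : forall x y, b1 x * b2 y = b2 y * b1 x.
Variable DeltaB : B -> BB.
Hypothesis hDB : unital_starhom DeltaB.
Hypothesis DB_alpha : DeltaB (kappa alpha) = b1 (kappa alpha) * b2 (kappa alpha)
  - q *: (b1 (star (kappa gamma) * z) * b2 (kappa gamma)).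
Hypothesis DB_gamma : DeltaB (kappa gamma) = b1 (kappa gamma) * b2 (kappa alpha)
  + b1 (star (kappa alpha) * z) * b2 (kappa gamma).
Hypothesis DB_z : DeltaB z = b1 z * b2 z.

(* [twin l u v] relates [u] in the braided tensor square to its image [v] under
   the algebraic homomorphism [iota1 x * iota2 y |-> x z^(deg y) (x) y], with all
   the terms of [u] of total degree [l]. The homomorphism itself is not needed. *)
Inductive twin (l : int) : AA -> BB -> Prop :=
| twin0 : twin l 0 0
| twinD n m x y u v of hpoly n x & hpoly m y & n + m = l & twin l u v :
    twin l (iota1 x * iota2 y + u)
           (b1 (kappa x * upow z m) * b2 (kappa y) + v).

Lemma twin_term n m x y : hpoly n x -> hpoly m y ->
  twin (n + m) (iota1 x * iota2 y) (b1 (kappa x * upow z m) * b2 (kappa y)).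
Proof.
move=> hx hy; rewrite -[X in twin _ X]addr0 -[X in twin _ _ X]addr0.
exact: twinD hx hy _ (twin0 _).
Qed.

Lemma twin_add l u v u' v' : twin l u v -> twin l u' v' -> twin l (u + u') (v + v').
Proof.
move=> t t'; elim: t => [|n m x y u1 v1 hx hy nm _ IH]; first by rewrite !add0r.
by rewrite -!addrA; exact: twinD hx hy nm IH.
Qed.

Lemma twin_scale l k u v : twin l u v -> twin l (k *: u) (k *: v).
Proof.
elim=> [|n m x y u1 v1 hx hy nm _ IH]; first by rewrite !scaler0; left.
rewrite !scalerDr !scalerAl -(starhomZ hi1) -(starhomZ hb1) scalerAl.
by rewrite -(starhomZ hk); exact: twinD (hpolyZ k hx) hy nm IH.
Qed.

Lemma upow_kappa n m x : hpoly n x ->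
  upow z m * kappa x = zeta ^ (- (n * m)) *: (kappa x * upow z m).
Proof.
move=> hx; rewrite (@upow_comm _ _ _ _ (zeta ^ (- n))) ?expfz_neq0 //.
  by rewrite exprz_exp mulNr.
exact: z_kappa.
Qed.

(** The heart of the comparison: moving [iota2 y] past [iota1 x'] and moving [z^m] past [kappa x']
    produce the same scalar [zeta ^ (- (n' * m))]. *)
Lemma twin_mul_term n m x y l u v : hpoly n x -> hpoly m y -> twin l u v ->
  twin (n + m + l) (iota1 x * iota2 y * u)
    (b1 (kappa x * upow z m) * b2 (kappa y) * v).
Proof.
move=> hx hy; elim=> [|n' m' x' y' u1 v1 hx' hy' <- _ IH].
  by rewrite !mulr0; left.
rewrite !mulrDr; apply: twin_add IH.
have -> : n + m + (n' + m') = n + n' + (m + m') by rewrite addrACA.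
pose c := zeta ^ (- (n' * m)).
have -> : iota1 x * iota2 y * (iota1 x' * iota2 y') =
    iota1 (c *: (x * x')) * iota2 (y * y').
  rewrite -mulrA [iota2 y * _]mulrA (braid hx' hy) -/c (starhomZ hi1).
  by rewrite !(starhomM hi1, starhomM hi2) -!(scalerAl, scalerAr) !mulrA.
have -> : b1 (kappa x * upow z m) * b2 (kappa y) *
      (b1 (kappa x' * upow z m') * b2 (kappa y')) =
    b1 (kappa (c *: (x * x')) * upow z (m + m')) * b2 (kappa (y * y')).
  rewrite -mulrA [b2 _ * _]mulrA -b12 -mulrA mulrA -(starhomM hb1) -(starhomM hb2).
  rewrite -(starhomM hk); congr (b1 _ * _).
  rewrite -mulrA [upow z m * _]mulrA (upow_kappa _ hx') -/c (starhomZ hk).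
  by rewrite (starhomM hk) upowD // -!(scalerAl, scalerAr) !mulrA.
by apply: twin_term; [apply/hpolyZ/hpolyM|apply: hpolyM].
Qed.

Lemma twin_mul l l' u v u' v' : twin l u v -> twin l' u' v' ->
  twin (l + l') (u * u') (v * v').
Proof.
move=> t t'; elim: t => [|n m x y u1 v1 hx hy <- _ IH].
  by rewrite !mul0r; left.
by rewrite !mulrDl; apply: twin_add IH; apply: twin_mul_term.
Qed.

Lemma twin_star l u v : twin l u v -> twin (- l) (star u) (star v).
Proof.
elim=> [|n m x y u1 v1 hx hy <- _ IH]; first by rewrite !star0; left.
rewrite !starD; apply: twin_add; last by [].
have [hx' hy'] := (hpoly_star hx, hpoly_star hy).
pose c := zeta ^ (- (- n * - m)).
have -> : star (iota1 x * iota2 y) = iota1 (c *: star x) * iota2 (star y).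
  rewrite starM -(starhomS hi1) -(starhomS hi2) (braid hx' hy') -/c.
  by rewrite (starhomZ hi1) scalerAl.
have -> : star (b1 (kappa x * upow z m) * b2 (kappa y)) =
    b1 (kappa (c *: star x) * upow z (- m)) * b2 (kappa (star y)).
  rewrite starM -(starhomS hb1) -(starhomS hb2) -b12 starM upow_star.
  rewrite -!(starhomS hk) (upow_kappa _ hx') -/c.
  by rewrite (starhomZ hk) scalerAl.
by rewrite opprD; apply: twin_term; first exact: hpolyZ.
Qed.

(** On generators, each [z] in [DeltaB] stands next to a second leg [gamma], of degree 1. The rest
    follows as [twin] respects all the operations. *)
Lemma twin_Delta n x : hpoly n x -> twin n (DeltaA x) (DeltaB (kappa x)).
Proof.
have [ha hg] := (hpoly_alpha alpha gamma, hpoly_gamma alpha gamma).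
elim=> {n x}.
- by move=> n; rewrite (starhom0 hDA) (starhom0 hk) (starhom0 hDB); left.
- have := twin_term (hpoly1 _ _) (hpoly1 _ _).
  by rewrite !(starhom1 hi1, starhom1 hi2, starhom1 hk, upow0, mulr1, starhom1 hb1,
    starhom1 hb2, starhom1 hDA, starhom1 hDB).
- rewrite DA_alpha DB_alpha -!scaleNr; apply: twin_add.
    by have := twin_term ha ha; rewrite upow0 mulr1.
  apply: twin_scale; have := twin_term (hpoly_star hg) hg.
  by rewrite upow1 (starhomS hk).
- rewrite DA_gamma DB_gamma; apply: twin_add.
    by have := twin_term hg ha; rewrite upow0 mulr1.
  have := twin_term (hpoly_star ha) hg.
  by rewrite upow1 (starhomS hk).
- move=> n x y _ IHx _ IHy.
  by rewrite (starhomD hDA) (starhomD hk) (starhomD hDB); apply: twin_add.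
- move=> n k x _ IHx.
  by rewrite (starhomZ hDA) (starhomZ hk) (starhomZ hDB); apply: twin_scale.
- move=> m n x y _ IHx _ IHy.
  by rewrite (starhomM hDA) (starhomM hk) (starhomM hDB); apply: twin_mul.
- move=> n x _ IHx.
  by rewrite (starhomS hDA) (starhomS hk) (starhomS hDB); apply: twin_star.
Qed.

Variables (hB : B -> C) (El Er : BB -> B).
Hypotheses (hB_lin : scalar hB) (hB1 : hB 1 = 1).
Hypotheses (El_lin : linear El) (Er_lin : linear Er).
Hypothesis ElE : forall x y, El (b1 x * b2 y) = hB x *: y.
Hypothesis ErE : forall x y, Er (b1 x * b2 y) = hB y *: x.
Hypothesis El_Delta : forall x, El (DeltaB x) = hB x *: 1.
Hypothesis Er_Delta : forall x, Er (DeltaB x) = hB x *: 1.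
Hypothesis theta_ex : forall t : C, `|t| = 1 -> exists2 theta : B -> B,
  unital_starhom theta &
  theta z = z /\ forall n x, hpoly n x -> theta (kappa x) = t ^ n *: kappa x.

(** The coproduct of [z^m], as [z] is group-like. *)
Let zz m := b1 (upow z m) * b2 (upow z m).

Let Delta_zz x m : DeltaB (x * upow z m) = DeltaB x * zz m.
Proof.
rewrite (starhomM hDB) (starhom_upow _ _ hDB) DB_z upowM_comm //.
by rewrite -(starhom_upow _ _ hb1) -(starhom_upow _ _ hb2).
Qed.

Let term_zz x m j y : b1 (kappa x * upow z j) * b2 (kappa y) * zz m =
  b1 (kappa x * upow z (j + m)) * b2 (kappa y * upow z m).
Proof.
rewrite /zz -mulrA [b2 _ * _]mulrA -b12 -mulrA mulrA -(starhomM hb1) -(starhomM hb2).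
by rewrite upowD // mulrA.
Qed.

(* The Haar state is invariant under the gauge action [theta]: evaluate
   [h ((theta (x) theta^-1) Delta)] by slicing either leg first. *)
Lemma haar_degree0 n x m : hpoly n x -> n != 0 -> hB (kappa x * upow z m) = 0.
Proof.
move=> hx n0; have [t t1 tn] := circle_expz_neq1 C n0.
have t0 : t != 0 by rewrite -normr_eq0 t1 oner_neq0.
have [th hth [thz thk]] := theta_ex t1.
have tV1 : `|t^-1| = 1 by rewrite normfV t1 invr1.
have [th' hth' [th'z th'k]] := theta_ex tV1.
(* On a term of degrees [i + j = l], applying [th] to the first leg gives [t^i], and applying [th']
   to the second gives [t^(-j)]. *)
have swap l u v : twin l u v ->
    hB (th (Er (v * zz m))) = t ^ l * hB (th' (El (v * zz m))).
  elim=> [|i j y y' u1 v1 hy hy' <- _ IH].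
    rewrite mul0r (linear_fun0 Er_lin) (linear_fun0 El_lin).
    by rewrite (starhom0 hth) (starhom0 hth') (scalar_fun0 hB_lin) mulr0.
  rewrite mulrDl (linear_funD Er_lin) (linear_funD El_lin).
  rewrite (starhomD hth) (starhomD hth') !(scalar_funD hB_lin) IH mulrDr.
  congr (_ + _); rewrite term_zz ErE ElE (starhomZ hth) (starhomZ hth').
  rewrite (starhomM hth) (starhomM hth') (starhom_upow _ _ hth).
  rewrite (starhom_upow _ _ hth') thz th'z (thk _ _ hy) (th'k _ _ hy').
  rewrite -!scalerAl !(scalar_funZ hB_lin) exprz_inv expfzDr // -invr_expz.
  by field; rewrite expfz_neq0.
(* For a coproduct both slices are the scalar [c], the value of [hB] in question; so [c = t^n * c]
   with [t^n != 1]. *)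
have := swap _ _ _ (twin_Delta hx).
rewrite -Delta_zz Er_Delta El_Delta (starhomZ hth) (starhomZ hth').
rewrite (starhom1 hth) (starhom1 hth') (scalar_funZ hB_lin) hB1 mulr1.
set c := hB _ => /eqP; rewrite -subr_eq0 -{1}[c]mul1r -mulrBl mulf_eq0.
by rewrite subr_eq0 eq_sym (negPf tn) => /eqP.
Qed.

Hypothesis kappa_inj : forall n x, hpoly n x -> kappa x = 0 -> x = 0.
Variables (h : A -> C) (h_id id_h : AA -> A).
Hypothesis hE : forall x, h x = hB (kappa x).
Hypotheses (h_id_lin : linear h_id) (id_h_lin : linear id_h).
Hypothesis h_idE : forall x y, h_id (iota1 x * iota2 y) = h x *: y.
Hypothesis id_hE : forall x y, id_h (iota1 x * iota2 y) = h y *: x.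

Let h0 n x : hpoly n x -> n != 0 -> h x = 0.
Proof. by move=> hx n0; rewrite hE -[kappa x]mulr1 -(upow0 z) (haar_degree0 _ hx). Qed.

(** The factor [zz (- l)] turns a first leg [kappa x * z^j] into [kappa x * z^(-i)], where
    [i + j = l]. Slicing kills it unless [i = 0], and then no power of [z] is left. *)
Lemma hpoly_h_id n a : hpoly n a -> h_id (DeltaA a) = h a *: 1.
Proof.
move=> ha; have slice l u v : twin l u v ->
    El (v * zz (- l)) = kappa (h_id u) * upow z (- l) /\ hpoly l (h_id u).
  elim=> [|i j x y u1 v1 hx hy ij _ [IH1 IH2]].
    rewrite mul0r (linear_fun0 El_lin) (linear_fun0 h_id_lin) (starhom0 hk).
    by rewrite mul0r; split=> //; exact: hpoly0.
  rewrite mulrDl (linear_funD El_lin) (linear_funD h_id_lin) IH1 (starhomD hk).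
  rewrite mulrDl term_zz ElE h_idE.
  have [i0|i0] := eqVneq i 0.
    split; last by apply: hpolyD IH2; apply: hpolyZ; rewrite -ij i0 add0r.
    by rewrite -ij i0 add0r subrr upow0 mulr1 hE (starhomZ hk) scalerAl.
  rewrite (haar_degree0 _ hx i0) (h0 hx i0) !scale0r (starhom0 hk) mul0r !add0r.
  by split.
have [eq_a ha'] := slice _ _ _ (twin_Delta ha).
move: eq_a; rewrite -Delta_zz El_Delta.
have [n0|n0] := eqVneq n 0.
  rewrite n0 oppr0 upow0 !mulr1 -hE => eq_a; apply: subr0_eq.
  (* Injectivity of [kappa] is available on homogeneous elements; here the difference has degree
     0. *)
  apply: (kappa_inj (n := 0)); first last.
    by rewrite (starhomB hk) (starhomZ hk) (starhom1 hk) eq_a subrr.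
  rewrite -scaleN1r; apply: hpolyD; first by rewrite -n0.
  by do 2 apply: hpolyZ; exact: hpoly1.
rewrite (haar_degree0 _ ha n0) (h0 ha n0) !scale0r => eq_a.
apply: kappa_inj ha' _.
by rewrite -[kappa _]mulr1 -(proj1 (upow_unitary n uz)) upow_star mulrA -eq_a mul0r.
Qed.

(** On this side no correction by [zz] is required: the slice kills terms with [j != 0], and
    [z^j = 1] in the others. *)
Lemma hpoly_id_h n a : hpoly n a -> id_h (DeltaA a) = h a *: 1.
Proof.
move=> ha; have slice l u v : twin l u v ->
    Er v = kappa (id_h u) /\ hpoly l (id_h u).
  elim=> [|i j x y u1 v1 hx hy ij _ [IH1 IH2]].
    rewrite (linear_fun0 Er_lin) (linear_fun0 id_h_lin) (starhom0 hk).
    by split=> //; exact: hpoly0.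
  rewrite (linear_funD Er_lin) (linear_funD id_h_lin) IH1 (starhomD hk).
  rewrite ErE id_hE -hE.
  have [j0|j0] := eqVneq j 0.
    split; last by apply: hpolyD IH2; apply: hpolyZ; rewrite -ij j0 addr0.
    by rewrite j0 upow0 mulr1 (starhomZ hk).
  by rewrite (h0 hy j0) !scale0r (starhom0 hk) !add0r; split.
have [eq_a ha'] := slice _ _ _ (twin_Delta ha).
move: eq_a; rewrite Er_Delta -hE.
have [n0|n0] := eqVneq n 0.
  move=> eq_a; apply: subr0_eq; apply: (kappa_inj (n := 0)); first last.
    by rewrite (starhomB hk) (starhomZ hk) (starhom1 hk) eq_a subrr.
  rewrite -scaleN1r; apply: hpolyD; first by rewrite -n0.
  by do 2 apply: hpolyZ; exact: hpoly1.
by rewrite (h0 ha n0) !scale0r => eq_a; apply: kappa_inj ha' _.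
Qed.

End Invariance.

(** * The braided tensor product and the bosonization *)

Lemma circle_coordinate_unitary (C : numClosedFieldType) (CT : cstarAlgType C)
    (ev : CT -> C -> C) (z : CT) :
  is_circle_algebra ev -> (forall t, circle t -> ev z t = t) -> unitary z.
Proof.
case=> ev_hom ev_inj _ _ evz.
split; apply: ev_inj => t; rewrite inE => ct;
  have [_ [ev1 evM] evS] := ev_hom t ct; rewrite evM evS evz // ev1.
  by rewrite mulrC -normCK ct expr1n.
by rewrite -normCK ct expr1n.
Qed.

Lemma torus_upow_comm (C : numClosedFieldType) (T : cstarAlgType C) (zeta : C)
    (u v : T) m n : zeta != 0 -> torus_rel zeta [:: u; v] ->
  upow v m * upow u n = zeta ^ (- (n * m)) *: (upow u n * upow v m).
Proof.
move=> zeta0 [uu uv uvE].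
have uX := upow_comm n uu zeta0 uvE.
rewrite (@upow_comm _ _ _ _ (zeta ^ (- n))) ?expfz_neq0 //.
  by rewrite exprz_exp mulNr.
by rewrite uX scalerA -expfzDr // addNr expr0z scale1r.
Qed.

(** Inside [T] the two copies of [A] commute with each other and with the torus, so the scalar comes
    only from exchanging [V^m] and [U^n]. *)
Lemma braided_tensor_comm (C : numClosedFieldType) (A T2 TA T AA : cstarAlgType C)
    (hom : int -> A -> Prop) (zeta : C) (U V : T2) (p1 : T2 -> TA) (p2 : A -> TA)
    (k1 : TA -> T) (k2 : A -> T) (j : AA -> T) (iota1 iota2 : A -> AA) :
  zeta != 0 -> torus_rel zeta [:: U; V] -> is_tensor p1 p2 -> is_tensor k1 k2 ->
  is_braided_tensor hom U V p1 p2 k1 k2 j iota1 iota2 ->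
  forall n m x y, hom n x -> hom m y ->
  iota2 y * iota1 x = zeta ^ (- (n * m)) *: (iota1 x * iota2 y).
Proof.
move=> zeta0 UV hp hk [[hj j_inj] _ jl jr _] n m x y hx hy; apply: j_inj.
have [hp1 hk1] := (tensor_legl hp, tensor_legl hk).
rewrite (starhomZ hj) !(starhomM hj) (jl _ _ hx) (jr _ _ hy).
rewrite -mulrA -(tensor_leg_comm hk) mulrA -(starhomM hk1) mulrA -(starhomM hp1).
rewrite (torus_upow_comm _ _ zeta0 UV) (starhomZ hp1) (starhomM hp1).
rewrite [k1 _ * (k1 _ * _)]mulrA -(starhomM hk1) -[in RHS]mulrA.
rewrite -(tensor_leg_comm hp) -scalerAl (starhomZ hk1) -scalerAl.
by rewrite mulrA.
Qed.

Section Bosonization.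
Variables (C : numClosedFieldType) (q zeta : C).
Hypothesis zeta1 : `|zeta| = 1.
Variables (A B : cstarAlgType C) (alpha gamma : A) (zB : B) (kappa : A -> B).
Hypothesis hk : unital_starhom kappa.
Hypothesis B_univ :
  is_universal (@boson_rel _ q zeta) [:: kappa alpha; kappa gamma; zB].

Let zeta0 : zeta != 0. Proof. by rewrite -normr_eq0 zeta1 oner_neq0. Qed.

Lemma boson_unitary : unitary zB. Proof. by case: B_univ => -[]. Qed.

(** Conjugation by [zB] after [kappa] is a *-homomorphism that scales [gamma] by [zeta^-1], so
    [hpoly_twist] applies. *)
Lemma boson_kappa_comm n x : hpoly alpha gamma n x ->
  zB * kappa x = zeta ^ (- n) *: (kappa x * zB).
Proof.
have [[_ [z1 z2] za zg] _ _] := B_univ; move=> hx.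
pose ad (x : A) : B := zB * kappa x * star zB.
have had : unital_starhom ad.
  split=> [k y y'||y]; rewrite /ad.
  - rewrite (starhomD hk) (starhomZ hk) mulrDr mulrDl.
    by rewrite -scalerAr -scalerAl.
  - split=> [|y y']; first by rewrite (starhom1 hk) mulr1.
    by rewrite (starhomM hk) !mulrA -[_ * star zB * zB]mulrA z1 mulr1.
  - by rewrite (starhomS hk) !starM starK mulrA.
have zV1 : `|zeta^-1| = 1 by rewrite normfV zeta1 invr1.
have adE : ad x = upow (zeta^-1 *: 1) n * kappa x.
  apply: (hpoly_twist had hk (scalar_unitary _ zV1) _ za _ hx) => [y|].
    by rewrite -scalerAl -scalerAr mul1r mulr1.
  by rewrite -scalerAl mul1r.
rewrite upow_scalar // -scalerAl mul1r exprz_inv in adE.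
by rewrite scalerAl -adE /ad -[RHS]mulrA z1 mulr1.
Qed.

Lemma boson_gauge (t : C) : `|t| = 1 -> exists2 theta : B -> B,
  unital_starhom theta & theta zB = zB /\
    forall n x, hpoly alpha gamma n x -> theta (kappa x) = t ^ n *: kappa x.
Proof.
move=> t1; have [[rel uz za zg] _ univ] := B_univ.
have ut := scalar_unitary B t1.
have tcomm (y : B) : t *: 1 * y = y * (t *: 1).
  by rewrite -scalerAl -scalerAr mul1r mulr1.
have [|theta hth [tha thg thz]] :=
    univ B [:: kappa alpha; t *: 1 * kappa gamma; zB].
  split=> //; first exact: SUq2_rel_twist.
  by rewrite mulrA -tcomm -!mulrA [zB * _]mulrA zg -scalerAr.
exists theta => //; split=> // n x hx.
have := hpoly_twist (unital_starhom_comp hth hk) hk ut _ tha thg hx.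
by move=> /= ->; rewrite ?upow_scalar // -scalerAl mul1r.
Qed.

(* [B] acts on [C(T^2_zeta) (x) A] with [x] homogeneous going to
   [V^(deg x) (x) x] and [z] to [U^* (x) 1]. *)
Lemma boson_kappa_inj (T2 TA : cstarAlgType C) (U V : T2)
    (p1 : T2 -> TA) (p2 : A -> TA) :
  SUq2_rel q [:: alpha; gamma] -> torus_rel zeta [:: U; V] -> is_tensor p1 p2 ->
  forall n x, hpoly alpha gamma n x -> kappa x = 0 -> x = 0.
Proof.
move=> rel [uU uV UV] hp n x hx kx0.
have [hp1 hp2] := (tensor_legl hp, tensor_legr hp).
have rel2 : SUq2_rel q [:: p2 alpha; p2 gamma].
  case: rel => r1 r2 r3 r4; split; rewrite -?(starhomS hp2) -!(starhomM hp2).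
  - by rewrite -(starhomD hp2) r1 (starhom1 hp2).
  - by rewrite -(starhomZ hp2) -(starhomD hp2) r2 (starhom1 hp2).
  - by rewrite -(starhomZ hp2) r3.
  - by rewrite r4.
have uV1 := starhom_unitary hp1 uV.
have [uU1 U1s] : unitary (p1 (star U)) /\ star (p1 (star U)) = p1 U.
  by rewrite -(starhomS hp1) starK; split=> //; apply/starhom_unitary/unitary_star.
have [_ _ univ] := B_univ.
have [|psi hpsi [psia psig psiz]] :=
    univ TA [:: p2 alpha; p1 V * p2 gamma; p1 (star U)].
  split=> //.
  - by apply: SUq2_rel_twist => //; apply: tensor_leg_comm hp _ _.
  - rewrite U1s (tensor_leg_comm hp) -mulrA -(starhomM hp1).
    by rewrite (proj1 uU) (starhom1 hp1) mulr1.
  - rewrite U1s -!mulrA -(tensor_leg_comm hp) !mulrA -!(starhomM hp1).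
    (* This is why [z] goes to the adjoint of [U]: it gives the relation between [z] and [gamma] in
       [B]. *)
    have -> : star U * V * U = zeta^-1 *: V.
      apply: (scalerI zeta0); rewrite scalerA mulfV // scale1r.
      by rewrite -mulrA scalerAr -UV mulrA (proj1 uU) mul1r.
    by rewrite (starhomZ hp1) -scalerAl.
(* Now [psi (kappa x)] is the unitary [upow (p1 V) n] times [p2 x], so [kappa x = 0] forces
   [p2 x = 0]. *)
have := hpoly_twist (unital_starhom_comp hpsi hk) hp2 uV1 _ psia psig hx.
rewrite /= kx0 (starhom0 hpsi) => /(_ (fun y => tensor_leg_comm hp V y)) px0.
apply: (tensor_legr_inj hp); rewrite (starhom0 hp2) -[LHS]mul1r.
by rewrite -(proj1 (upow_unitary n uV1)) -mulrA -px0 mulr0.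
Qed.

End Bosonization.

(** * Extension from polynomials to the whole of [A] *)

Lemma ucp_pos (C : numClosedFieldType) (A D : cstarAlgType C) (f : A -> D) x :
  ucp f -> exists w, f (star x * x) = star w * w.
Proof.
case=> _ _ /(_ 1%N (const_mx (star x * x)))[].
  exists (const_mx x); apply/matrixP=> i k.
  by rewrite !mxE big_ord1 !mxE.
move=> Y /matrixP/(_ 0 0); rewrite !mxE big_ord1 !mxE => ->.
by exists (Y 0 0).
Qed.

Theorem corollary3p3 (R : realType) (q : R[i]) (hq : 0 < `|q| < 1)
  (* the C*-algebra A *)
  (A : cstarAlgType R[i]) (alpha gamma : A)
  (hA : is_universal (@SUq2_rel _ q) [:: alpha; gamma])
  (* the coaction rho of the circle on A, with values in C(T) (x) A *)
  (CT CTA : cstarAlgType R[i]) (ev : CT -> R[i] -> R[i])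
  (hCT : is_circle_algebra ev)
  (z : CT) (hz : forall t : R[i], circle t -> ev z t = t)
  (c1 : CT -> CTA) (c2 : A -> CTA) (hCTA : is_tensor c1 c2)
  (rho : A -> CTA) (hrho : unital_starhom rho)
  (hrho_alpha : rho alpha = c2 alpha) (hrho_gamma : rho gamma = c1 z * c2 gamma)
  (* the noncommutative torus and T = (C(T^2_zeta) (x) A) (x) A *)
  (T2 : cstarAlgType R[i]) (U V : T2)
  (hT2 : is_universal (@torus_rel _ (q / q^*)) [:: U; V])
  (TA T : cstarAlgType R[i])
  (p1 : T2 -> TA) (p2 : A -> TA) (hTA : is_tensor p1 p2)
  (k1 : TA -> T) (k2 : A -> T) (hT : is_tensor k1 k2)
  (* the braided tensor product and the comultiplication of A *)
  (AA : cstarAlgType R[i]) (j : AA -> T) (iota1 iota2 : A -> AA)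
  (hAA : is_braided_tensor (homogeneous c1 c2 rho z) U V p1 p2 k1 k2
           j iota1 iota2)
  (DeltaA : A -> AA) (hDeltaA : unital_starhom DeltaA)
  (hDeltaA_alpha : DeltaA alpha = iota1 alpha * iota2 alpha
     - q *: (iota1 (star gamma) * iota2 gamma))
  (hDeltaA_gamma : DeltaA gamma = iota1 gamma * iota2 alpha
     + iota1 (star alpha) * iota2 gamma)
  (* the bosonization B, its Haar state, and the state h = hB \o kappa *)
  (B : cstarAlgType R[i]) (alphaB gammaB zB : B)
  (hB_univ : is_universal (@boson_rel _ q (q / q^*)) [:: alphaB; gammaB; zB])
  (BB : cstarAlgType R[i]) (b1 b2 : B -> BB) (hBB : is_tensor b1 b2)
  (DeltaB : B -> BB) (hDeltaB : unital_starhom DeltaB)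
  (hDeltaB_alpha : DeltaB alphaB = b1 alphaB * b2 alphaB
     - q *: (b1 (star gammaB * zB) * b2 gammaB))
  (hDeltaB_gamma : DeltaB gammaB = b1 gammaB * b2 alphaB
     + b1 (star alphaB * zB) * b2 gammaB)
  (hDeltaB_z : DeltaB zB = b1 zB * b2 zB)
  (hB : B -> R[i]) (hB_haar : is_haar_state b1 b2 DeltaB hB)
  (kappa : A -> B) (hkappa : unital_starhom kappa)
  (hkappa_alpha : kappa alpha = alphaB) (hkappa_gamma : kappa gamma = gammaB)
  (h : A -> R[i]) (hh : forall a, h a = hB (kappa a))
  (* the braided slice maps h [x] id and id [x] h *)
  (h_id id_h : AA -> A)
  (hh_id : is_slice_l iota1 iota2 h h_id)
  (hid_h : is_slice_r iota1 iota2 h id_h) :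
  forall a : A, h_id (DeltaA a) = id_h (DeltaA a) /\ id_h (DeltaA a) = h a *: 1.
Proof.
case/andP: hq => q_gt0 _; have q0 : q != 0 by rewrite -normr_gt0.
have zeta1 : `|q / q^*| = 1 by rewrite normrM normfV norm_conjC divff ?normr_eq0.
have zeta0 : q / q^* != 0 by rewrite -normr_eq0 zeta1 oner_neq0.
subst alphaB gammaB.
case: hA => relA genA _; case: hT2 => relT2 _ _.
have [hc1 hc2] := (tensor_legl hCTA, tensor_legr hCTA).
have uz := circle_coordinate_unitary hCT hz.
have hom n x : hpoly alpha gamma n x -> homogeneous c1 c2 rho z n x.
  move=> hx; rewrite /homogeneous (starhom_upow _ _ hc1).
  apply: (hpoly_twist hrho hc2 (starhom_unitary hc1 uz) _ _ hrho_gamma hx) => //.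
  by move=> y; apply: tensor_leg_comm.
have braid n m x y : hpoly alpha gamma n x -> hpoly alpha gamma m y ->
    iota2 y * iota1 x = (q / q^*) ^ (- (n * m)) *: (iota1 x * iota2 y).
  move=> /hom hx /hom hy.
  exact: (braided_tensor_comm zeta0 relT2 hTA hT hAA).
have [_ [hi1 hi2] _ _ _] := hAA.
have kappa_inj := boson_kappa_inj zeta1 hkappa hB_univ relA relT2 hTA.
have [hb1 hb2] := (tensor_legl hBB, tensor_legr hBB).
have b12 := tensor_leg_comm hBB.
have uzB := boson_unitary hB_univ.
have zk := boson_kappa_comm zeta1 hkappa hB_univ.
have gauge := boson_gauge hkappa hB_univ.
have [[hB_lin hB1 hB_pos] [El [Er [[[El_lin _ _] ElE] [[Er_lin _ _] ErE] ElD ErD]]]] := hB_haar.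
have [ucpl h_idE] := hh_id; have [ucpr id_hE] := hid_h.
have [h_id_lin _ _] := ucpl; have [id_h_lin _ _] := ucpr.
have left_poly := hpoly_h_id zeta0 hi1 hi2 braid hDeltaA hDeltaA_alpha hDeltaA_gamma
  uzB hkappa zk hb1 hb2 b12 hDeltaB hDeltaB_alpha hDeltaB_gamma hDeltaB_z
  hB_lin hB1 El_lin Er_lin ElE ErE ElD ErD gauge kappa_inj hh h_id_lin h_idE.
have right_poly := hpoly_id_h zeta0 hi1 hi2 braid hDeltaA hDeltaA_alpha hDeltaA_gamma
  uzB hkappa zk hb1 hb2 b12 hDeltaB hDeltaB_alpha hDeltaB_gamma hDeltaB_z
  hB_lin hB1 El_lin Er_lin ElE ErE ElD ErD gauge kappa_inj hh id_h_lin id_hE.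
have h_lin : scalar h.
  move=> k x y; rewrite !hh (starhomD hkappa) (starhomZ hkappa).
  by rewrite (scalar_funD hB_lin) (scalar_funZ hB_lin).
have h_pos x : 0 <= h (star x * x).
  by rewrite hh (starhomM hkappa) (starhomS hkappa).
have dense := hpoly_span_dense genA.
(* The spatial tensor product of [CT] and [A] comes with a faithful representation [pi] of [A] on a
   Hilbert space. *)
case: hCTA => _ _ _ [H1 [H [L [ip1 [ip [ipL [t [pi1 [pi [pi12 []]]]]]]]]]].
case=> _ hilb _ _ [_ hpi _] [_ fth _] _.
have extend (E : AA -> A) : ucp E ->
    (forall n x, hpoly alpha gamma n x -> E (DeltaA x) = h x *: 1) ->
    forall x, E (DeltaA x) = h x *: 1.
  move=> ucpE E_poly; have [E_lin _ _] := ucpE.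
  apply: (positive_map_scalar (F := E \o DeltaA) hilb hpi fth _ _ h_lin h_pos dense).
  - by move=> k x y /=; rewrite (starhomD hDeltaA) (starhomZ hDeltaA) E_lin.
  - by move=> x /=; rewrite (starhomM hDeltaA) (starhomS hDeltaA); apply: ucp_pos.
  - move=> x /=; elim=> [|n x1 y1 hx1 _ IH].
      by rewrite (starhom0 hDeltaA) (linear_fun0 E_lin) (scalar_fun0 h_lin) scale0r.
    rewrite (starhomD hDeltaA) (linear_funD E_lin) IH (E_poly _ _ hx1).
    by rewrite (scalar_funD h_lin) scalerDl.
move=> a; split; last exact: extend ucpr right_poly a.
by rewrite (extend _ ucpl left_poly) (extend _ ucpr right_poly).
Qed.
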